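(* Let $\mathbb{T}$ be a time scale with $a,b\in\mathbb{T}$, $a<b$, and let $f$ and $g$ be two (real-valued) $\Delta$-differentiable functions on $]a,b[$. Suppose that either $g^\Delta>0$ everywhere on $]a,\rho(b)[$ or $g^\Delta<0$ everywhere on $]a,\rho(b)[$. \begin{enumerate} \item If $\dfrac{f^\Delta}{g^\Delta}$ is increasing (resp. decreasing) on $]a,\rho(b)[$ and $f(a^+)$ and $g(a^+)$ exist (finite), then the function $$x\mapsto\frac{f(x)-f(a^+)}{g(x)-g(a^+)}$$ is also increasing (resp. decreasing) on $]a,\rho(b)[$. \item If $\dfrac{f^\Delta}{g^\Delta}$ is increasing (resp. decreasing) on $]a,\rho(b)[$ and $f(b^-)$ and $g(b^-)$ exist (finite), then the function $$x\mapsto\frac{f(x)-f(b^-)}{g(x)-g(b^-)}$$ is also increasing (resp. decreasing) on $]a,\rho(b)[$. \end{enumerate}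
   Context: A time scale $\mathbb{T}$ is a nonempty closed subset of $\mathbb{R}$. The forward and backward jump operators are $\sigma(t)=\inf\{s\in\mathbb{T}:s>t\}$ and $\rho(t)=\sup\{s\in\mathbb{T}:s<t\}$ (with $\inf\emptyset=\sup\mathbb{T}$, $\sup\emptyset=\inf\mathbb{T}$). A function $f$ is $\Delta$-differentiable at $t$ with delta derivative $f^\Delta(t)\in\mathbb{R}$ if for every $\varepsilon>0$ there is a neighbourhood $U$ of $t$ in $\mathbb{T}$ such that $|f(\sigma(t))-f(s)-f^\Delta(t)(\sigma(t)-s)|\le\varepsilon|\sigma(t)-s|$ for all $s\in U$. All intervals are time scale intervals, i.e. intersections of real intervals with $\mathbb{T}$; $]c,d[$ denotes the open interval $\{t\in\mathbb{T}:c<t<d\}$. The notation $f(a^+)$ means $\lim_{x\to a^+}f(x)$ and $f(b^-)$ means $\lim_{x\to b^-}f(x)$. ''Increasing'' and ''decreasing'' are meant in the strict sense. *)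

(* Defs.v *)
From HB Require Import structures.
From mathcomp Require Import all_boot all_order all_algebra.
From mathcomp Require Import all_classical all_reals all_analysis.

Set Implicit Arguments.
Unset Strict Implicit.
Unset Printing Implicit Defensive.

Import Order.TTheory GRing.Theory Num.Theory.
Import numFieldNormedType.Exports.

Local Open Scope classical_set_scope.
Local Open Scope ring_scope.

Definition time_scale (R : realType) (T : set R) : Prop :=
  T !=set0 /\ closed T.

(* The convention is inf set0 = sup T here, whereas the library's [inf] of the
   empty set is 0; likewise for [rho]. *)
Definition sigma (R : realType) (T : set R) (t : R) : R :=
  let A := [set s | T s /\ t < s] in
  if `[< A !=set0 >] then inf A else sup T.

Definition rho (R : realType) (T : set R) (t : R) : R :=
  let A := [set s | T s /\ s < t] in
  if `[< A !=set0 >] then sup A else inf T.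

Definition ts_oo (R : realType) (T : set R) (c d : R) : set R :=
  [set t | T t /\ c < t < d].

(* Functions on a time scale T are represented by total functions R -> R; only
   their values on T are ever used. *)
Definition is_delta_derive (R : realType) (T : set R) (f : R -> R) (t d : R)
  : Prop :=
  forall e : R, 0 < e ->
    \forall s \near nbhs t, T s ->
      `|f (sigma T t) - f s - d * (sigma T t - s)| <= e * `|sigma T t - s|.

Definition delta_derivable (R : realType) (T : set R) (f : R -> R) (t : R)
  : Prop := exists d : R, is_delta_derive T f t d.

(* The delta derivative is unique at every point of T that is not a
   left-scattered maximum of T, in particular at every point of T lying
   strictly below some other point of T. *)
Definition delta_derive (R : realType) (T : set R) (f : R -> R) (t : R) : R :=
  get [set d | is_delta_derive T f t d].

(* One-sided limits along T. A limit at c is only meaningful when c is an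
   accumulation point of T from the relevant side: otherwise the filter
   [within T c^'+] is trivial and everything converges along it. *)
Definition has_right_lim (R : realType) (T : set R) (f : R -> R) (c : R)
  : Prop :=
  limit_point (T `&` [set x | c < x]) c /\ cvg (f x @[x --> within T c^'+]).

Definition right_lim (R : realType) (T : set R) (f : R -> R) (c : R) : R :=
  lim (f x @[x --> within T c^'+]).

Definition has_left_lim (R : realType) (T : set R) (f : R -> R) (c : R)
  : Prop :=
  limit_point (T `&` [set x | x < c]) c /\ cvg (f x @[x --> within T c^'-]).

Definition left_lim (R : realType) (T : set R) (f : R -> R) (c : R) : R :=
  lim (f x @[x --> within T c^'-]).

Definition increasing_on (R : realType) (D : set R) (h : R -> R) : Prop :=
  forall x y, D x -> D y -> x < y -> h x < h y.

Definition decreasing_on (R : realType) (D : set R) (h : R -> R) : Prop :=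
  forall x y, D x -> D y -> x < y -> h y < h x.

(* Main.v *)
(* Take g^Delta > 0 and r = f^Delta / g^Delta increasing.  A function with
   nonnegative delta derivative is nondecreasing; applied to M g - f and
   f - M g this bounds the slope (f y - f x) / (g y - g x) between r x and r y
   for x < y.  Going to the limit at a, and using a point u with a < u < x to
   gain strictness, the quotient at x is < r x, hence less than the slope
   between x and y.  The quotient at y is the mediant of these two fractions,
   so it exceeds the quotient at x.  The limit at b is handled in the same
   way, with a point between y and b. *)
Require Import Defs.
From HB Require Import structures.
From mathcomp Require Import all_boot all_order all_algebra.
From mathcomp Require Import all_classical all_reals all_analysis.
From mathcomp Require Import ring lra.

Set Implicit Arguments.
Unset Strict Implicit.
Unset Printing Implicit Defensive.

Import Order.TTheory GRing.Theory Num.Theory.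
Import numFieldNormedType.Exports.

Local Open Scope classical_set_scope.
Local Open Scope ring_scope.

(** * Linearity and continuity for delta derivatives, and growth from their sign *)

Lemma is_delta_derive_comb (R : realType) (T : set R) (f g : R -> R)
    (t df dg p q : R) :
  is_delta_derive T f t df -> is_delta_derive T g t dg ->
  is_delta_derive T (fun x => p * f x + q * g x) t (p * df + q * dg).
Proof.
move=> Df Dg e e0.
(* The summand 1 keeps the divisor positive when [p] and [q] both vanish. *)
have C0 : 0 < `|p| + `|q| + 1 by rewrite ltr_wpDl // addr_ge0.
have k0 : 0 < e / (`|p| + `|q| + 1) by rewrite divr_gt0.
near=> s => Ts.
have Hf : T s -> `|f (sigma T t) - f s - df * (sigma T t - s)| <=
    e / (`|p| + `|q| + 1) * `|sigma T t - s| by near: s; exact: Df.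
have Hg : T s -> `|g (sigma T t) - g s - dg * (sigma T t - s)| <=
    e / (`|p| + `|q| + 1) * `|sigma T t - s| by near: s; exact: Dg.
move: (Hf Ts) (Hg Ts).
set k := e / _; set X := f _ - _ - _; set Y := g _ - _ - _ => hX hY.
have -> : p * f (sigma T t) + q * g (sigma T t) - (p * f s + q * g s) -
   (p * df + q * dg) * (sigma T t - s) = p * X + q * Y by rewrite /X /Y; ring.
rewrite (le_trans (ler_normD _ _)) // !normrM.
have -> : e = k * (`|p| + `|q| + 1) by rewrite /k divfK // gt_eqF.
have pX := ler_wpM2l (normr_ge0 p) hX; have qY := ler_wpM2l (normr_ge0 q) hY.
have : 0 <= k * `|sigma T t - s| by rewrite mulr_ge0 // ltW.
lra.
Unshelve. all: by end_near. Qed.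

Lemma is_delta_derive_id (R : realType) (T : set R) (t : R) :
  is_delta_derive T id t 1.
Proof.
by move=> e e0; near=> s => _; rewrite mul1r subrr normr0 mulr_ge0 // ltW.
Unshelve. all: by end_near. Qed.

(** Comparing the derivative estimate at [s] with the one at [t] itself cancels [h (sigma T t)]. *)
Lemma is_delta_derive_cvg (R : realType) (T : set R) (h : R -> R) (t d : R) :
  T t -> is_delta_derive T h t d -> h x @[x --> within T (nbhs t)] --> h t.
Proof.
move=> Tt Dh; apply/cvgrPdist_lt => eps eps0.
set m := `|sigma T t - t|.
have m0 : 0 <= m by rewrite normr_ge0.
have K0 : 0 < m *+ 2 + 1 + `|d| by rewrite ltr_wpDr // ltr_wpDl // mulrn_wge0.
(* With [|t - s| < e <= 1], the total error [e * (m + |t - s|) + e * m + |d| * |t - s|] is at most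
   [e * (2 * m + 1 + |d|)], hence at most [eps / 2]. *)
pose e := Num.min 1 (eps / 2 / (m *+ 2 + 1 + `|d|)).
have e0 : 0 < e by rewrite lt_min ltr01 !divr_gt0.
have De := Dh _ e0.
have Dt := nbhs_singleton De Tt.
have Hd : \forall s \near t, `|t - s| < e.
  exact: (@cvgr_dist_lt _ _ _ (nbhs t) _ id).
rewrite near_withinE; near=> s => Ts.
have Ds : T s -> `|h (sigma T t) - h s - d * (sigma T t - s)| <=
    e * `|sigma T t - s| by near: s.
have ts : `|t - s| < e by near: s.
have {}Ds := Ds Ts.
have e1 : e <= 1 by rewrite ge_min lexx.
have eK : e * (m *+ 2 + 1 + `|d|) <= eps / 2.
  by rewrite -ler_pdivlMr // ge_min lexx orbT.
have st : `|sigma T t - s| <= m + `|t - s|.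
  by rewrite (_ : _ - s = (sigma T t - t) + (t - s)) ?ler_normD //; ring.
set X := h (sigma T t) - h s - _ in Ds.
set Y := h (sigma T t) - h t - _ in Dt.
have -> : h t - h s = X - Y + d * (t - s) by rewrite /X /Y; ring.
have H1 := ler_normD (X - Y) (d * (t - s)).
have H2 := ler_normB X Y.
rewrite -/m in Dt.
rewrite normrM in H1.
rewrite mulr2n in eK.
have d0 := normr_ge0 d; have s0 := normr_ge0 (t - s).
nra.
Unshelve. all: by end_near. Qed.

(* If c is right-scattered, take s = sigma c; otherwise any s > c close to c. *)
Lemma delta_derive_gt0_step (R : realType) (T : set R) (h : R -> R)
    (c v d : R) :
  closed T -> T c -> T v -> c < v -> is_delta_derive T h c d -> 0 < d ->
  exists s, [/\ T s, c < s, s <= v & h c < h s].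
Proof.
move=> clT Tc Tv cv Dh d0.
pose A := [set s | T s /\ c < s].
have A0 : A !=set0 by exists v.
have lA : has_lbound A by exists c => s [_ /ltW].
have sE : sigma T c = inf A by rewrite /sigma asboolT.
(* Tolerance [d / 2] leaves an increase of at least [d / 2] times the length of the step. *)
have d2 : 0 < d / 2 by rewrite divr_gt0.
have := Dh _ d2; rewrite sE => Dd.
have mv : inf A <= v by exact: ge_inf.
have : c <= inf A by apply: lb_le_inf => // s [_ /ltW].
rewrite le_eqVlt => /predU1P[cm|cm].
  move/nbhs_ballP : Dd => [/= r r0 Hr].
  have [|s [Ts cs] ss] := @inf_adherent _ A (Num.min r (v - c)) _ (conj A0 lA).
    by rewrite lt_min r0 subr_gt0.
  rewrite -cm -ltrBlDl lt_min in ss.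
  move/andP : ss => [sr sv].
  exists s; split => //; first by lra.
  have := Hr s; rewrite /ball /= -cm distrC gtr0_norm ?subr_gt0// => /(_ sr Ts).
  by rewrite ler_norml; nra.
have Tm : T (inf A).
  apply: clT => U /nbhs_ballP[r /= r0 rU].
  have [s [Ts cs] sr] := inf_adherent r0 (conj A0 lA).
  exists s; split => //; apply: rU.
  have ms : inf A <= s by apply: ge_inf.
  by rewrite /ball /= distrC ger0_norm ?subr_ge0// ltrBlDl.
exists (inf A); split => //.
have := nbhs_singleton Dd Tc.
by rewrite ler_norml gtr0_norm ?subr_gt0//; nra.
Qed.

(** A supremum argument replaces induction along [T]: the points at which [h] is at least an earlier
    value must reach [v], since otherwise one more step would pass their supremum. *)
Lemma delta_derive_gt0_lt (R : realType) (T : set R) (h h' : R -> R)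
    (u v : R) :
  closed T -> T u -> T v -> u < v ->
  (forall t, T t -> u <= t <= v -> is_delta_derive T h t (h' t)) ->
  (forall t, T t -> u <= t < v -> 0 < h' t) ->
  h u < h v.
Proof.
move=> clT Tu Tv uv Dh h'0.
have step c : T c -> u <= c -> c < v ->
    exists s, [/\ T s, c < s, s <= v & h c < h s].
  move=> Tc uc cv; apply: (delta_derive_gt0_step clT Tc Tv cv).
    by apply: Dh => //; rewrite uc ltW.
  by apply: h'0 => //; rewrite uc.
(* This first step provides the strictness; from [w] on, a weak bound suffices. *)
have [w [Tw uw wv huw]] := step _ Tu (lexx u) uv.
apply: (lt_le_trans huw).
pose A := [set s | [/\ T s, w <= s, s <= v & h w <= h s]].
have A0 : A !=set0 by exists w; split.
have uA : has_ubound A by exists v => s [].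
have wc : w <= sup A by apply: ub_le_sup => //; split.
have cv : sup A <= v by apply: ge_sup => // s [].
have clA := closure_sup A0 uA.
have Tc : T (sup A).
  by apply: clT; apply: closure_subset clA => s [].
have hc : h w <= h (sup A).
  (* Otherwise continuity forces [h < h w] on [T] near [sup A], where [A] has points. *)
  rewrite leNgt; apply/negP => hcw.
  have /(is_delta_derive_cvg Tc) : is_delta_derive T h (sup A) (h' (sup A)).
    by apply: Dh => //; rewrite cv (le_trans (ltW uw)).
  move=> /cvgr_lt /(_ _ hcw) hn.
  have [s [[Ts _ _ ws] /(_ Ts)]] := clA _ hn.
  by rewrite ltNge ws.
move: cv; rewrite le_eqVlt => /predU1P[<-//|cv].
have [s [Ts cs sv hs]] := step _ Tc (le_trans (ltW uw) wc) cv.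
suff : s <= sup A by rewrite leNgt cs.
apply: ub_le_sup => //; split => //; first by rewrite (le_trans wc) ?ltW.
by rewrite (le_trans hc) ?ltW.
Qed.

Lemma delta_derive_ge0_le (R : realType) (T : set R) (h h' : R -> R)
    (u v : R) :
  closed T -> T u -> T v -> u < v ->
  (forall t, T t -> u <= t <= v -> is_delta_derive T h t (h' t)) ->
  (forall t, T t -> u <= t < v -> 0 <= h' t) ->
  h u <= h v.
Proof.
(* Apply the strict version to h + k id and let k tend to 0. *)
move=> clT Tu Tv uv Dh h'0; apply/ler_addgt0Pl => e e0.
pose k := e / (v - u).
have k0 : 0 < k by rewrite divr_gt0 // subr_gt0.
have := @delta_derive_gt0_lt _ T (fun x => 1 * h x + k * x)
  (fun x => 1 * h' x + k * 1) u v clT Tu Tv uv.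
have -> : e = k * v - k * u by rewrite -mulrBr divfK // subr_eq0 gt_eqF.
have H1 t : T t -> u <= t <= v -> is_delta_derive T
   (fun x => 1 * h x + k * x) t (1 * h' t + k * 1).
  move=> Tt ut; apply: is_delta_derive_comb; first exact: Dh.
  exact: is_delta_derive_id.
have H2 t : T t -> u <= t < v -> 0 < 1 * h' t + k * 1.
  by move=> Tt ut; have := h'0 _ Tt ut; lra.
by move=> /(_ H1 H2); lra.
Qed.

(** * Slope bounds from the quotient of delta derivatives *)

(** An inequality stands in for Cauchy's mean value theorem, whose equality can fail on a time
    scale. *)
Lemma delta_slope_le (R : realType) (T : set R) (f g f' g' : R -> R)
    (u v M : R) :
  closed T -> T u -> T v -> u < v ->
  (forall t, T t -> u <= t <= v -> is_delta_derive T f t (f' t)) ->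
  (forall t, T t -> u <= t <= v -> is_delta_derive T g t (g' t)) ->
  (forall t, T t -> u <= t < v -> f' t <= M * g' t) ->
  f v - f u <= M * (g v - g u).
Proof.
move=> clT Tu Tv uv Df Dg fg.
have D t : T t -> u <= t <= v ->
    is_delta_derive T (fun x => -1 * f x + M * g x) t (-1 * f' t + M * g' t).
  by move=> Tt ut; apply: is_delta_derive_comb; [exact: Df | exact: Dg].
have D0 t : T t -> u <= t < v -> 0 <= -1 * f' t + M * g' t.
  by move=> Tt ut; have := fg _ Tt ut; lra.
by have := delta_derive_ge0_le clT Tu Tv uv D D0; lra.
Qed.

Lemma delta_slope_ge (R : realType) (T : set R) (f g f' g' : R -> R)
    (u v M : R) :
  closed T -> T u -> T v -> u < v ->
  (forall t, T t -> u <= t <= v -> is_delta_derive T f t (f' t)) ->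
  (forall t, T t -> u <= t <= v -> is_delta_derive T g t (g' t)) ->
  (forall t, T t -> u <= t < v -> M * g' t <= f' t) ->
  M * (g v - g u) <= f v - f u.
Proof.
move=> clT Tu Tv uv Df Dg fg.
have D t : T t -> u <= t <= v ->
    is_delta_derive T (fun x => 1 * f x + - M * g x) t (1 * f' t + - M * g' t).
  by move=> Tt ut; apply: is_delta_derive_comb; [exact: Df | exact: Dg].
have D0 t : T t -> u <= t < v -> 0 <= 1 * f' t + - M * g' t.
  by move=> Tt ut; have := fg _ Tt ut; lra.
by have := delta_derive_ge0_le clT Tu Tv uv D D0; lra.
Qed.

(** Properness lets inequalities pass to one-sided limits and turns eventual properties into actual
    points of [T]. *)
Lemma within_limit_point_proper (X : topologicalType) (T A : set X) (c : X) :
  limit_point (T `&` A) c -> ProperFilter (within T (within A (nbhs c))).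
Proof.
move=> Lc; apply: Build_ProperFilter => /Lc[y [_ [Ty Ay] /(_ Ay Ty)]].
by [].
Qed.

(** On [[x, y[] the increasing quotient [f' / g'] stays between its values at [x] and [y], which
    serve as the constants [M] of the slope lemmas. *)
Lemma ts_oo_delta_bounds (R : realType) (T : set R) (c d : R)
    (f g f' g' : R -> R) (x y : R) :
  closed T ->
  (forall t, ts_oo T c d t -> is_delta_derive T f t (f' t)) ->
  (forall t, ts_oo T c d t -> is_delta_derive T g t (g' t)) ->
  (forall t, ts_oo T c d t -> 0 < g' t) ->
  increasing_on (ts_oo T c d) (fun t => f' t / g' t) ->
  ts_oo T c d x -> ts_oo T c d y -> x < y ->
  [/\ g x < g y,
      f' x / g' x * (g y - g x) <= f y - f x &
      f y - f x <= f' y / g' y * (g y - g x)].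
Proof.
move=> clT Df Dg g0 incr Dx Dy xy.
have [[Tx /andP[cx xd]] [Ty /andP[cy yd]]] := (Dx, Dy).
have sub t : T t -> x <= t <= y -> ts_oo T c d t.
  move=> Tt /andP[xt ty]; split => //.
  by rewrite (lt_le_trans cx xt) (le_lt_trans ty yd).
have sub' t : T t -> x <= t < y -> ts_oo T c d t.
  by move=> Tt /andP[xt ty]; apply: sub => //; rewrite xt ltW.
split.
- by apply: (@delta_derive_gt0_lt _ T g g') => // t Tt ut; auto.
- apply: (@delta_slope_ge _ T f g f' g') => // t Tt ut; auto.
  have Dt := sub' _ Tt ut.
  rewrite -ler_pdivlMr ?g0//.
  case/andP : ut; rewrite le_eqVlt => /predU1P[->//|xt _].
  by apply: ltW; exact: incr.
- apply: (@delta_slope_le _ T f g f' g') => // t Tt ut; auto.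
  have Dt := sub' _ Tt ut.
  rewrite -ler_pdivrMr ?g0//.
  by case/andP : ut => _ ty; apply: ltW; exact: incr.
Qed.

(** * Monotone quotients based at one-sided limits *)

Lemma right_lim_quotient_increasing (R : realType) (T : set R) (a c : R)
    (f g f' g' : R -> R) (lf lg : R) :
  closed T -> limit_point (T `&` [set x | a < x]) a ->
  (forall t, ts_oo T a c t -> is_delta_derive T f t (f' t)) ->
  (forall t, ts_oo T a c t -> is_delta_derive T g t (g' t)) ->
  f x @[x --> within T a^'+] --> lf -> g x @[x --> within T a^'+] --> lg ->
  (forall t, ts_oo T a c t -> 0 < g' t) ->
  increasing_on (ts_oo T a c) (fun t => f' t / g' t) ->
  increasing_on (ts_oo T a c) (fun x => (f x - lf) / (g x - lg)).
Proof.
move=> clT La Df Dg flf glg g0 incr x y Dx Dy xy.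
have PF : ProperFilter (within T a^'+) := within_limit_point_proper La.
have bnd := ts_oo_delta_bounds clT Df Dg g0 incr.
have [Tx /andP[ax xc]] := Dx.
have [u [ua [Tu au] ux]] := La _ (lt_nbhsl ax).
rewrite /= in ux au.
have Du : ts_oo T a c u by split => //; rewrite au (lt_trans ux).
have near_lt v : ts_oo T a c v ->
    \forall s \near within T a^'+, ts_oo T a c s /\ s < v.
  move=> [_ /andP[av vc]]; rewrite !near_withinE; near=> s => as_ Ts.
  have sv : s < v by near: s; exact: lt_nbhsl.
  by split=> //; split=> //; rewrite as_ (lt_trans sv vc).
have lg_le v : ts_oo T a c v -> lg <= g v.
  move=> Dv; apply: (cvgr_to_le glg); near=> s.
  have [Ds sv] : ts_oo T a c s /\ s < v by near: s; exact: near_lt.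
  by have [/ltW] := bnd _ _ Ds Dv sv.
(* The limit only gives a weak bound; a further point [w < u] makes it strict. *)
have lgu : lg < g u.
  have [w [Dw wu]] := filter_ex (near_lt _ Du).
  by have [gwu _ _] := bnd _ _ Dw Du wu; rewrite (le_lt_trans (lg_le _ Dw)).
set r := fun t => f' t / g' t.
have lfu : f u - lf <= r u * (g u - lg).
  rewrite -subr_ge0.
  (* Regrouped so that the single function [f s - r u * g s] passes to the limit. *)
  have -> : r u * (g u - lg) - (f u - lf) =
            (lf - r u * lg) - (f u - r u * g u) by ring.
  rewrite subr_ge0.
  apply: (@cvgr_to_ge _ _ PF _ (fun s => f s - r u * g s)).
    by apply: cvgB => //; apply: cvgMl_tmp.
  near=> s.
  have [Ds su] : ts_oo T a c s /\ s < u by near: s; exact: near_lt.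
  by have [_ _] := bnd _ _ Ds Du su; rewrite -/(r u); lra.
have rux : r u < r x by exact: incr.
have [gux _ fux] := bnd _ _ Du Dx ux.
have [gxy fxy _] := bnd _ _ Dx Dy xy.
rewrite -/(r x) in fux fxy.
have gx0 : 0 < g x - lg by rewrite subr_gt0 (lt_trans lgu).
have gy0 : 0 < g y - lg by rewrite (lt_trans gx0) // ltrD2r.
(* Split at [u]: the part up to [u] has slope at most [r u < r x], with [g u - lg > 0]. *)
have fx : f x - lf < r x * (g x - lg) by nra.
by rewrite ltr_pdivrMr // mulrAC ltr_pdivlMr //; nra.
Unshelve. all: by end_near. Qed.

(** Here the quotient at [x] is the mediant of the slope between [x] and [y], at most [r y], and the
    quotient at [y], which exceeds [r y]. *)
Lemma left_lim_quotient_increasing (R : realType) (T : set R) (c b : R)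
    (f g f' g' : R -> R) (lf lg : R) :
  closed T -> limit_point (T `&` [set x | x < b]) b ->
  (forall t, ts_oo T c b t -> is_delta_derive T f t (f' t)) ->
  (forall t, ts_oo T c b t -> is_delta_derive T g t (g' t)) ->
  f x @[x --> within T b^'-] --> lf -> g x @[x --> within T b^'-] --> lg ->
  (forall t, ts_oo T c b t -> 0 < g' t) ->
  increasing_on (ts_oo T c b) (fun t => f' t / g' t) ->
  increasing_on (ts_oo T c b) (fun x => (f x - lf) / (g x - lg)).
Proof.
move=> clT Lb Df Dg flf glg g0 incr x y Dx Dy xy.
have PF : ProperFilter (within T b^'-) := within_limit_point_proper Lb.
have bnd := ts_oo_delta_bounds clT Df Dg g0 incr.
have [Ty /andP[cy yb]] := Dy.
have [u [ub [Tu bu] yu]] := Lb _ (lt_nbhsr yb).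
rewrite /= in yu bu.
have Du : ts_oo T c b u by split => //; rewrite bu (lt_trans _ yu).
have near_gt v : ts_oo T c b v ->
    \forall s \near within T b^'-, ts_oo T c b s /\ v < s.
  move=> [_ /andP[cv vb]]; rewrite !near_withinE; near=> s => sb Ts.
  have vs : v < s by near: s; exact: lt_nbhsr.
  by split=> //; split=> //; rewrite sb (lt_trans cv vs).
have lg_ge v : ts_oo T c b v -> g v <= lg.
  move=> Dv; apply: (cvgr_to_ge glg); near=> s.
  have [Ds vs] : ts_oo T c b s /\ v < s by near: s; exact: near_gt.
  by have [/ltW] := bnd _ _ Dv Ds vs.
have lgu : g u < lg.
  have [w [Dw uw]] := filter_ex (near_gt _ Du).
  by have [guw _ _] := bnd _ _ Du Dw uw; rewrite (lt_le_trans guw) ?lg_ge.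
set r := fun t => f' t / g' t.
have lfu : r u * (lg - g u) <= lf - f u.
  rewrite -subr_ge0.
  have -> : (lf - f u) - r u * (lg - g u) =
            (lf - r u * lg) - (f u - r u * g u) by ring.
  rewrite subr_ge0.
  apply: (@cvgr_to_ge _ _ PF _ (fun s => f s - r u * g s)).
    by apply: cvgB => //; apply: cvgMl_tmp.
  near=> s.
  have [Ds us] : ts_oo T c b s /\ u < s by near: s; exact: near_gt.
  by have [_ + _] := bnd _ _ Du Ds us; rewrite -/(r u); lra.
have ryu : r y < r u by exact: incr.
have [gyu fyu _] := bnd _ _ Dy Du yu.
have [gxy _ fxy] := bnd _ _ Dx Dy xy.
rewrite -/(r y) in fyu fxy.
have gy0 : 0 < lg - g y by rewrite subr_gt0 (lt_trans gyu).
have gx0 : 0 < lg - g x by rewrite (lt_trans gy0) // ltrD2l ltrN2.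
have fy : r y * (lg - g y) < lf - f y by nra.
(* Since [g] stays below [lg], both differences are reversed to get positive denominators. *)
have swap p l q m : (p - l) / (q - m) = (l - p) / (m - q) :> R.
  by rewrite -(opprB l) -(opprB m) invrN mulrNN.
by rewrite !(swap _ lf) ltr_pdivrMr // mulrAC ltr_pdivlMr //; nra.
Unshelve. all: by end_near. Qed.

(* The negative and decreasing cases follow from the positive increasing one by
   replacing f or g by its opposite. *)
Lemma monotone_quotient_signs (R : realType) (T D : set R)
    (F : set_system R) :
  Filter F ->
  (forall (f g f' g' : R -> R) (lf lg : R),
    (forall t, D t -> is_delta_derive T f t (f' t)) ->
    (forall t, D t -> is_delta_derive T g t (g' t)) ->
    f x @[x --> F] --> lf -> g x @[x --> F] --> lg ->
    (forall t, D t -> 0 < g' t) ->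
    increasing_on D (fun t => f' t / g' t) ->
    increasing_on D (fun x => (f x - lf) / (g x - lg))) ->
  forall (f g f' g' : R -> R) (lf lg : R),
    (forall t, D t -> is_delta_derive T f t (f' t)) ->
    (forall t, D t -> is_delta_derive T g t (g' t)) ->
    f x @[x --> F] --> lf -> g x @[x --> F] --> lg ->
    (forall t, D t -> 0 < g' t) \/ (forall t, D t -> g' t < 0) ->
    (increasing_on D (fun t => f' t / g' t) ->
     increasing_on D (fun x => (f x - lf) / (g x - lg))) /\
    (decreasing_on D (fun t => f' t / g' t) ->
     decreasing_on D (fun x => (f x - lf) / (g x - lg))).
Proof.
move=> FF H f g f' g' lf lg Df Dg flf glg g0.
have DN (h h' : R -> R) : (forall t, D t -> is_delta_derive T h t (h' t)) ->
    forall t, D t -> is_delta_derive T (\- h) t (- h' t).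
  move=> Dh t Dt; have := is_delta_derive_comb (-1) 0 (Dh _ Dt) (Dh _ Dt).
  by under eq_fun do rewrite mul0r addr0 mulN1r; rewrite mul0r addr0 mulN1r.
have cN (h : R -> R) l : h x @[x --> F] --> l -> (- h x) @[x --> F] --> - l.
  exact: cvgN.
have NE (p q l m : R) : (- p - - l) / (q - m) = - ((p - l) / (q - m)).
  by rewrite -opprD mulNr.
have EN (p q l m : R) : (p - l) / (- q - - m) = - ((p - l) / (q - m)).
  by rewrite -opprD invrN mulrN.
have ND (k l : R -> R) : (forall x, l x = - k x) ->
    (increasing_on D l <-> decreasing_on D k) /\
    (decreasing_on D l <-> increasing_on D k).
  move=> lk; split; split => m x y Dx Dy xy; have := m _ _ Dx Dy xy;
    by rewrite !lk ?ltrN2 // => ?; rewrite -ltrN2.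
case: g0 => [g0|g0].
- split; first exact: H.
  (* [g' > 0] and a decreasing quotient: negate [f] only. *)
  have := H _ _ _ _ _ _ (DN _ _ Df) Dg (cN _ _ flf) glg g0.
  move=> H1 d.
  apply/(ND _ _ (fun x => NE (f x) (g x) lf lg)).1; apply: H1.
  by apply/(ND _ _ (fun x => mulNr (f' x) (g' x)^-1)).1.
- have g0N t : D t -> 0 < - g' t by rewrite oppr_gt0; exact: g0.
  split.
    (* [g' < 0] and an increasing quotient: negate both, which changes neither quotient. *)
    have := H _ _ _ _ _ _ (DN _ _ Df) (DN _ _ Dg) (cN _ _ flf) (cN _ _ glg) g0N.
    have -> : (fun t => - f' t / - g' t) = (fun t => f' t / g' t).
      by apply/funext => t; rewrite invrN mulrNN.
    have -> // : (fun x => ((\- f) x - - lf) / ((\- g) x - - lg)) =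
                 (fun x => (f x - lf) / (g x - lg)).
    by apply/funext => t; rewrite NE EN opprK.
  (* [g' < 0] and a decreasing quotient: negate [g] only. *)
  have := H _ _ _ _ _ _ Df (DN _ _ Dg) flf (cN _ _ glg) g0N.
  move=> H1 d.
  apply/(ND _ _ (fun x => EN (f x) (g x) lf lg)).1; apply: H1.
  apply/(ND (fun x => f' x / g' x) _ _).1 => // x.
  by rewrite invrN mulrN.
Qed.

(** * The backward jump at [b], and assembly of both cases *)

Lemma rho_le (R : realType) (T : set R) (a b : R) :
  T a -> a < b -> rho T b <= b.
Proof.
move=> Ta ab; have A0 : [set s | T s /\ s < b] !=set0 by exists a.
by rewrite /rho asboolT //; apply: ge_sup => // s [_ /ltW].
Qed.

Lemma rho_left_dense (R : realType) (T : set R) (b : R) :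
  limit_point (T `&` [set x | x < b]) b -> rho T b = b.
Proof.
move=> Lb; have [a [_ [Ta ab] _]] := Lb _ (@filterT _ (nbhs b) _).
(* If [rho T b < b], a point of [T] would lie strictly between them, against the supremum. *)
apply/eqP; rewrite eq_le (rho_le Ta ab) /= leNgt; apply/negP => /lt_nbhsr/Lb.
move=> [s [_ [Ts sb] /=]]; rewrite ltNge => /negP; apply.
have A0 : [set s | T s /\ s < b] !=set0 by exists a.
rewrite /rho asboolT //; apply: ub_le_sup => //.
by exists b => x [_ /ltW].
Qed.

Theorem theorem2p1 (R : realType) (T : set R) (a b : R) (f g : R -> R)
  (hT : time_scale T) (ha : T a) (hb : T b) (hab : a < b)
  (hf : forall t, ts_oo T a b t -> delta_derivable T f t)
  (hg : forall t, ts_oo T a b t -> delta_derivable T g t)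
  (hg' : (forall t, ts_oo T a (rho T b) t -> 0 < delta_derive T g t) \/
         (forall t, ts_oo T a (rho T b) t -> delta_derive T g t < 0)) :
  let D := ts_oo T a (rho T b) in
  let r := fun x => delta_derive T f x / delta_derive T g x in
  (has_right_lim T f a -> has_right_lim T g a ->
    let q := fun x =>
      (f x - right_lim T f a) / (g x - right_lim T g a) in
    (increasing_on D r -> increasing_on D q) /\
    (decreasing_on D r -> decreasing_on D q)) /\
  (has_left_lim T f b -> has_left_lim T g b ->
    let q := fun x =>
      (f x - left_lim T f b) / (g x - left_lim T g b) in
    (increasing_on D r -> increasing_on D q) /\
    (decreasing_on D r -> decreasing_on D q)).
Proof.
move=> D r.
have DT t : D t -> ts_oo T a b t.
  move=> [Tt /andP[at_ tb]]; split => //.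
  by rewrite at_ (lt_le_trans tb (rho_le ha hab)).
(* Differentiability on [D] ensures that [get] picks a true derivative, not its default value. *)
have Df t : D t -> is_delta_derive T f t (delta_derive T f t).
  by move=> /DT/hf; exact: getPex.
have Dg t : D t -> is_delta_derive T g t (delta_derive T g t).
  by move=> /DT/hg; exact: getPex.
have clT := hT.2.
split=> -[Lf cf] [_ cg].
- apply: (monotone_quotient_signs _ _ Df Dg cf cg hg').
  by move=> *; apply: (right_lim_quotient_increasing clT Lf); eassumption.
(* A left limit makes [b] left-dense, so [D] is all of []a, b[] and contains points between any [y]
   in [D] and [b]. *)
- rewrite /D (rho_left_dense Lf) in Df Dg hg' *.
  apply: (monotone_quotient_signs _ _ Df Dg cf cg hg').
  by move=> *; apply: (left_lim_quotient_increasing clT Lf); eassumption.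
Qed.
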